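(* Let $G$ be a group and let $\delta_G$ be the discrete topology on $G$. Then $\delta_G$ is A-complete if and only if $G$ is a Taĭmanov group.
   Context: Group topologies are not assumed Hausdorff. A continuous group isomorphism $f:(G,\tau)\to(H,\sigma)$ of topological groups is semitopological if there exist a topological group $(\widetilde G,\widetilde\tau)$ containing $G$ as a normal subgroup with $\widetilde\tau$ inducing $\tau$ on $G$, and an open continuous homomorphism $\widetilde f:(\widetilde G,\widetilde\tau)\to(H,\sigma)$ extending $f$. A group topology $\tau$ on $G$ is A-complete if for every group topology $\sigma\le\tau$ on $G$ such that $id_G:(G,\tau)\to(G,\sigma)$ is semitopological, one has $\sigma=\tau$. The Taĭmanov topology $T_G$ on a group $G$ is the group topology whose neighborhoods of $e_G$ have as a base the centralizers $c_G(F)=\{x\in G: xg=gx\ \forall g\in F\}$ of finite subsets $F\subseteq G$. The group $G$ is Taĭmanov if $T_G$ is the discrete topology (equivalently, some finite $F\subseteq G$ has $c_G(F)=\{e_G\}$). *)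

(* Defs.v *)
From HB Require Import structures.
From mathcomp Require Import all_boot.
From mathcomp Require Import all_classical.
From mathcomp Require Import topology.

Set Implicit Arguments.
Unset Strict Implicit.
Unset Printing Implicit Defensive.

Local Open Scope classical_set_scope.
Local Open Scope group_scope.

Record topology_on (T : choiceType) := TopologyOn {
  opens : set_system T;
  opensT : opens setT;
  opensI : setI_closed opens;
  opens_bigcup : forall (I : Type) (U : I -> set T),
    (forall i, opens (U i)) -> opens (\bigcup_i U i) }.

(* Several topologies on one carrier have to be compared, so the library's
   topological structure is put on a copy of T tagged by the topology. *)
Definition topo_space (T : choiceType) (t : topology_on T) : Type := T.

HB.instance Definition _ (T : choiceType) (t : topology_on T) :=
  Choice.copy (topo_space t) T.
HB.instance Definition _ (T : choiceType) (t : topology_on T) :=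
  isOpenTopological.Build (topo_space t)
    (opensT t) (@opensI _ t) (@opens_bigcup _ t).

Lemma open_topo_space (T : choiceType) (t : topology_on T) :
  (open : set_system (topo_space t)) = opens t.
Proof. by []. Qed.

Lemma topology_on_eq (T : choiceType) (s t : topology_on T) :
  opens s = opens t -> s = t.
Proof.
case: s => os sT sI sU; case: t => ot tT tI tU /= e.
case: _ / e tT tI tU => tT tI tU.
by congr TopologyOn; exact: Prop_irrelevance.
Qed.

Record group_topology (G : groupType) := GroupTopology {
  gtop :> topology_on G;
  gtop_mul : continuous
    ((fun p => (p.1 : G) * (p.2 : G)) :
       topo_space gtop * topo_space gtop -> topo_space gtop);
  gtop_inv : continuous
    ((fun x => (x : G)^-1) : topo_space gtop -> topo_space gtop) }.

Lemma group_topology_eq (G : groupType) (s t : group_topology G) :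
  opens s = opens t -> s = t.
Proof.
move=> /topology_on_eq; case: s => s sM sV; case: t => t tM tV /= e.
case: _ / e tM tV => tM tV.
by congr GroupTopology; exact: Prop_irrelevance.
Qed.

Definition coarser (T : choiceType) (s t : topology_on T) : Prop :=
  opens s `<=` opens t.

Definition continuous_isomorphism (G H : groupType)
    (tau : group_topology G) (sigma : group_topology H) (f : G -> H) : Prop :=
  [/\ bijective f, {morph f : x y / x * y} &
      continuous (f : topo_space tau -> topo_space sigma)].

(* The inclusion of G into the larger group Gt is rendered by an injective
   homomorphism j, with G identified with its range. *)
Definition semitopological (G H : groupType)
    (tau : group_topology G) (sigma : group_topology H) (f : G -> H) : Prop :=
  continuous_isomorphism tau sigma f /\
  exists (Gt : groupType) (taut : group_topology Gt)
         (j : G -> Gt) (ft : Gt -> H),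
    [/\ injective j /\ {morph j : x y / x * y},
        forall x y : Gt, range j x -> range j (x ^ y),
        opens tau = [set j @^-1` V | V in opens taut],
        [/\ {morph ft : x y / x * y},
            continuous (ft : topo_space taut -> topo_space sigma) &
            forall V, opens taut V -> opens sigma (ft @` V)] &
        forall x : G, ft (j x) = f x].

Definition A_complete (G : groupType) (tau : group_topology G) : Prop :=
  forall sigma : group_topology G,
    coarser sigma tau -> semitopological tau sigma id -> sigma = tau.

Definition discrete_topology_on (T : choiceType) : topology_on T :=
  @TopologyOn T setT I (fun _ _ _ _ => I) (fun _ _ _ => I).

Lemma nbhs_discrete (T : choiceType)
    (x : topo_space (discrete_topology_on T)) : nbhs x [set x].
Proof. by apply: open_nbhs_nbhs; split. Qed.

Lemma discrete_mul (G : groupType) : let t := discrete_topology_on G in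
  continuous ((fun p => (p.1 : G) * (p.2 : G)) :
    topo_space t * topo_space t -> topo_space t).
Proof.
move=> t [x y] A /nbhs_singleton/= Axy.
by exists ([set x], [set y]) => [|[_ _] [/= -> ->]//]; split; exact: nbhs_discrete.
Qed.

Lemma discrete_inv (G : groupType) : let t := discrete_topology_on G in
  continuous ((fun x => (x : G)^-1) : topo_space t -> topo_space t).
Proof.
move=> t x A /nbhs_singleton/= Ax.
by apply: filterS (nbhs_discrete x) => _ ->.
Qed.

Definition discrete_group_topology (G : groupType) : group_topology G :=
  GroupTopology (@discrete_mul G) (@discrete_inv G).

Definition centralizer (G : groupType) (F : set G) : set G :=
  [set x | forall g, F g -> commute x g].

Section Taimanov.
Variable G : groupType.
Implicit Types (x y c d g : G) (F A : set G).

Lemma centralizer1 F : centralizer F 1.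
Proof. by move=> g _; rewrite /commute mul1g mulg1. Qed.

Lemma centralizerM F c d :
  centralizer F c -> centralizer F d -> centralizer F (c * d).
Proof. by move=> Fc Fd g Fg; rewrite /commute -mulgA (Fd _ Fg) mulgA (Fc _ Fg) mulgA. Qed.

Lemma centralizerV F c : centralizer F c -> centralizer F c^-1.
Proof.
move=> Fc g Fg; apply: (mulgI c); rewrite mulgA mulgV mul1g mulgA.
by rewrite (Fc _ Fg) mulgK.
Qed.

Lemma centralizerJ F c y :
  centralizer [set g ^ y^-1 | g in F] c -> centralizer F (c ^ y).
Proof.
move=> Fc g Fg; have := Fc _ (imageP (fun g => g ^ y^-1) Fg).
by move=> /(congr1 (fun z => z ^ y)); rewrite /= (conjMg c) (conjMg _ c) conjgKV.
Qed.

Definition taimanov_opens : set_system G :=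
  [set U | forall x, U x -> exists2 F : set G, finite_set F &
    forall c, centralizer F c -> U (x * c)].

Lemma taimanov_opensT : taimanov_opens setT.
Proof. by move=> x _; exists set0 => //; exact: finite_set0. Qed.

Lemma taimanov_opensI : setI_closed taimanov_opens.
Proof.
move=> A B oA oB x [/oA[E finE EA] /oB[F finF FB]].
exists (E `|` F) => [|c Cc]; first by rewrite finite_setU.
by split; [apply: EA|apply: FB] => g ?; apply: Cc; [left|right].
Qed.

Lemma taimanov_opens_bigcup (I : Type) (U : I -> set G) :
  (forall i, taimanov_opens (U i)) -> taimanov_opens (\bigcup_i U i).
Proof.
move=> oU x [i _ /oU[F finF FU]]; exists F => // c /FU Uxc.
by exists i.
Qed.

Definition taimanov_topology_on : topology_on G :=
  TopologyOn taimanov_opensT taimanov_opensI taimanov_opens_bigcup.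

Lemma nbhs_taimanov (x : topo_space taimanov_topology_on) A :
  nbhs x A <-> exists2 F : set G, finite_set F &
    [set (x : G) * c | c in centralizer F] `<=` A.
Proof.
rewrite nbhsE; split=> [[B [oB Bx] sBA]|[F finF FA]].
  have [F finF FB] := oB _ Bx; exists F => // _ [c Fc <-].
  exact/sBA/FB.
exists [set (x : G) * c | c in centralizer F] => //; split; last first.
  by exists 1; [exact: centralizer1|rewrite mulg1].
move=> _ [c Fc <-]; exists F => // d Fd.
by exists (c * d); [exact: centralizerM|rewrite mulgA].
Qed.

Lemma nbhs1_taimanov A :
  nbhs (1 : topo_space taimanov_topology_on) A <->
  exists2 F : set G, finite_set F & centralizer F `<=` A.
Proof.
rewrite nbhs_taimanov; split=> -[F finF FA]; exists F => //.
  by move=> c Fc; apply: FA; exists c => //; rewrite mul1g.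
by move=> _ [c Fc <-]; rewrite mul1g; exact: FA.
Qed.

Lemma taimanov_mul : let t := taimanov_topology_on in
  continuous ((fun p => (p.1 : G) * (p.2 : G)) :
    topo_space t * topo_space t -> topo_space t).
Proof.
move=> t [x y] A /nbhs_taimanov[F finF FA].
pose F' : set G := [set g ^ (y : G)^-1 | g in F].
exists ([set (x : G) * c | c in centralizer F'],
        [set (y : G) * c | c in centralizer F]) => [|[_ _] [/=[c Fc <-] [d Fd <-]]].
  split; apply/nbhs_taimanov; [exists F'|exists F] => //.
  exact: finite_image.
apply: FA; exists (c ^ (y : G) * d).
  by apply: centralizerM => //; exact: centralizerJ.
by rewrite conjgE !mulgA mulgK.
Qed.

Lemma taimanov_inv : let t := taimanov_topology_on in
  continuous ((fun x => (x : G)^-1) : topo_space t -> topo_space t).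
Proof.
move=> t x A /nbhs_taimanov[F finF FA].
pose F' : set G := [set g ^ ((x : G)^-1)^-1 | g in F].
apply/nbhs_taimanov; exists F' => [|_ [c Fc <-]]; first exact: finite_image.
apply: FA; exists (c^-1 ^ (x : G)^-1).
  by apply: centralizerJ; exact: centralizerV.
by rewrite conjgE invgM invgK !mulgA mulVg mul1g.
Qed.

Definition taimanov_topology : group_topology G :=
  GroupTopology taimanov_mul taimanov_inv.

End Taimanov.

Definition Taimanov (G : groupType) : Prop :=
  taimanov_topology G = discrete_group_topology G.

(* Main.v *)
Require Import Defs.
From mathcomp Require Import all_boot.
From mathcomp Require Import all_classical.
From mathcomp Require Import topology.

(** If [delta_G] is A-complete, it suffices to show that the identity from
    [delta_G] to [T_G] is semitopological. The witness is the semidirect product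
    of [G] by [G] acting by conjugation, which [(x, y) |-> (x * y, y)]
    identifies with [G * G]: the normal copy of [G] is the first factor, the
    extension of the identity is the first projection, and the subgroups
    [{(c, c) | c in c_G(F)}], [F] finite, form a base at the identity.

    Conversely let [F] be finite with trivial centralizer and let [ft] on [Gt]
    witness that [id] from [delta_G] to [sigma] is semitopological. Some
    neighbourhood [V] of [1] in [Gt] meets [G] only in [1]. As [G] is normal,
    commutators [[w, g]] with [g] in [F] lie in [G], and for [w] close to [1]
    they lie in [V], hence are trivial; so [ft w] centralizes [F] and equals [1].
    Since [ft] is open, [sigma] is discrete. *)

Set Implicit Arguments.
Unset Strict Implicit.
Unset Printing Implicit Defensive.

Local Open Scope classical_set_scope.
Local Open Scope group_scope.

Section GroupTopologyTheory.
Variables (G : groupType) (t : group_topology G).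

Lemma continuous_mulg (T : topologicalType) (f g : T -> topo_space t) :
  continuous f -> continuous g ->
  continuous ((fun x => (f x : G) * (g x : G)) : T -> topo_space t).
Proof.
move=> cf cg x.
exact: cvg_comp2 (cf x) (cg x) (@gtop_mul G t (f x, g x)).
Qed.

(** The commutator unfolds to [x^-1 * (h^-1 * (x * h))], a product of continuous maps. *)
Lemma continuous_commg (h : G) :
  continuous ((fun x => [~ (x : G), h]) : topo_space t -> topo_space t).
Proof.
have idc : continuous (id : topo_space t -> topo_space t) by move=> x; exact: cvg_id.
apply: continuous_mulg; first exact: gtop_inv.
apply: continuous_mulg; first exact: cst_continuous.
by apply: continuous_mulg => //; exact: cst_continuous.
Qed.

(** Each singleton [[set y]] is the preimage of [[set 1]] under the translation by [y^-1]. *)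
Lemma open1_discrete : opens t [set 1] -> t = discrete_group_topology G.
Proof.
move=> o1; apply: group_topology_eq; apply/seteqP; split=> // A _.
have -> : A = \bigcup_(i : {x | A x}) [set sval i].
  apply/seteqP; split=> [x Ax|x [[y Ay] _ /= -> //]].
  by exists (exist _ x Ax).
apply: opens_bigcup => -[y Ay] /=.
have /continuousP/(_ [set 1] o1) :
    continuous ((fun x => (y^-1 : G) * (x : G)) : topo_space t -> topo_space t).
  by apply: continuous_mulg => [|x]; [exact: cst_continuous|exact: cvg_id].
congr (opens t _); apply/seteqP; split=> x /=.
  by move=> /(congr1 (fun z => y * z)); rewrite mulgA mulgV mul1g mulg1.
by move=> ->; rewrite mulVg.
Qed.

End GroupTopologyTheory.

(** Conditions for a family of subgroups to be a neighbourhood base at [1] of a group topology;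
    [baseJ] makes conjugations continuous at [1]. *)
Record subgroup_base (K : groupType) (B : set_system K) : Prop := SubgroupBase {
  base_ex : B !=set0;
  baseI : forall M N, B M -> B N -> exists2 L, B L & L `<=` M `&` N;
  base1 : forall N, B N -> N 1;
  baseM : forall N c d, B N -> N c -> N d -> N (c * d);
  baseV : forall N c, B N -> N c -> N c^-1;
  baseJ : forall N y, B N -> exists2 M, B M & forall c, M c -> N (c ^ y) }.

Section SubgroupTopology.
Variables (K : groupType) (B : set_system K) (baseB : subgroup_base B).

Definition base_opens : set_system K :=
  [set U | forall x, U x -> exists2 N, B N & forall c, N c -> U (x * c)].

Lemma base_opensT : base_opens setT.
Proof. by move=> x _; have [N BN] := base_ex baseB; exists N. Qed.

Lemma base_opensI : setI_closed base_opens.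
Proof.
move=> U V oU oV x [/oU[M BM MU] /oV[N BN NV]].
have [L BL sL] := baseI baseB BM BN.
by exists L => // c /sL[/MU ? /NV].
Qed.

Lemma base_opens_bigcup (I : Type) (U : I -> set K) :
  (forall i, base_opens (U i)) -> base_opens (\bigcup_i U i).
Proof.
by move=> oU x [i _ /oU[N BN NU]]; exists N => // c /NU Uxc; exists i.
Qed.

Definition base_topology_on : topology_on K :=
  TopologyOn base_opensT base_opensI base_opens_bigcup.

Lemma nbhs_base (x : topo_space base_topology_on) A :
  nbhs x A <-> exists2 N, B N & forall c, N c -> A ((x : K) * c).
Proof.
rewrite nbhsE; split=> [[U [oU Ux] sUA]|[N BN NA]].
  by have [N BN NU] := oU _ Ux; exists N => // c /NU /sUA.
(* The coset of [N] at [x] is itself open, as [N] is closed under products. *)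
exists [set (x : K) * c | c in N] => [|_ [c Nc <-]]; last exact: NA.
split; last by exists 1; [exact: base1 BN|rewrite mulg1].
move=> _ [c Nc <-]; exists N => // d Nd.
by exists (c * d); [exact: (baseM baseB)|rewrite mulgA].
Qed.

Lemma base_mul : let t := base_topology_on in
  continuous ((fun p => (p.1 : K) * (p.2 : K)) :
    topo_space t * topo_space t -> topo_space t).
Proof.
move=> t [x y] A /nbhs_base[N BN NA].
(* Moving [c] past [y] turns it into [c ^ y], which must land in [N]. *)
have [M BM MN] := baseJ baseB (y : K) BN.
exists ([set (x : K) * c | c in M], [set (y : K) * c | c in N]).
  by split; apply/nbhs_base; [exists M|exists N] => // c ?; exists c.
move=> [_ _] [/= [c /MN Nc <-] [d Nd <-]].
have -> : x * c * (y * d) = x * y * (c ^ y * d) :> K.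
  by rewrite conjgE !mulgA mulgK.
by apply: NA; exact: (baseM baseB BN).
Qed.

Lemma base_inv : let t := base_topology_on in
  continuous ((fun x => (x : K)^-1) : topo_space t -> topo_space t).
Proof.
move=> t x A /nbhs_base[N BN NA].
have [M BM MN] := baseJ baseB (x : K)^-1 BN.
apply/nbhs_base; exists M => // c /(baseV baseB BM)/MN/NA.
by rewrite conjgE invgK !mulgA mulVg mul1g -invgM.
Qed.

Definition base_group_topology : group_topology K :=
  GroupTopology base_mul base_inv.

End SubgroupTopology.

Section DiagonalBase.
Variable G : groupType.

(** Members meet the first factor only in [1] and project onto the basic neighbourhoods of the
    Taĭmanov topology. *)
Definition diagonal_base : set_system (G * G)%type :=
  [set [set (c, c) | c in centralizer F] | F in @finite_set G].

Lemma diagonal_subgroup_base : subgroup_base diagonal_base.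
Proof.
split.
- by exists [set (c, c) | c in centralizer set0]; exists set0; first exact: finite_set0.
- move=> _ _ [E finE <-] [F finF <-].
  exists [set (c, c) | c in centralizer (E `|` F)].
    by exists (E `|` F) => //; rewrite /= finite_setU.
  by move=> _ [c Cc <-]; split; exists c => // g ?; apply: Cc; [left|right].
- by move=> _ [F _ <-]; exists 1; first exact: centralizer1.
- move=> _ _ _ [F _ <-] [c Fc <-] [d Fd <-].
  by exists (c * d); first exact: centralizerM.
- by move=> _ _ [F _ <-] [c Fc <-]; exists c^-1; first exact: centralizerV.
- move=> _ [a b] [F finF <-].
  (* The element [a * b^-1] keeps the conjugate of [(c, c)] by [(a, b)] on the diagonal; the other
     elements make [c ^ a] centralize [F]. *)
  pose E := (a * b^-1) |` [set g ^ a^-1 | g in F].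
  exists [set (c, c) | c in centralizer E].
    by exists E => //; rewrite /= finite_setU; split=> //; exact: finite_image.
  move=> _ [c Ec <-]; exists (c ^ a).
    by apply: centralizerJ => g Fg; apply: Ec; right.
  (* [c] commutes with [a * b^-1], so its conjugates by [a] and [b] agree. *)
  congr (_, _); have : commute c (a * b^-1) by apply: Ec; left.
  move=> /commgP/conjg_fixP; rewrite conjgM => /(congr1 (conjg^~ b)).
  by rewrite conjgKV.
Qed.

Definition diagonal_topology : group_topology (G * G)%type :=
  base_group_topology diagonal_subgroup_base.

Lemma semitopological_taimanov :
  semitopological (discrete_group_topology G) (taimanov_topology G) id.
Proof.
split; first split=> //; first by exists id.
  by move=> x A /nbhs_singleton Ax; apply: filterS (nbhs_discrete x) => _ ->.
exists (G * G)%type, diagonal_topology, (fun x => (x, 1)), fst; split=> //.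
- split=> [x y [] //|x y]; congr (_, _); by rewrite mulg1.
- move=> _ [a b] [x _ <-]; exists (x ^ a) => //.
  by congr (_, _); rewrite -/(1 ^ b) conj1g.
- apply/seteqP; split=> // A _.
  (* The union of the left cosets of the whole diagonal through the points [(x, 1)]; it meets the
     first factor exactly in [A]. *)
  exists [set (x * c, c) | x in A & c in [set: G]].
    move=> _ [x Ax [c _ <-]].
    exists [set (d, d) | d in centralizer set0].
      by exists set0; first exact: finite_set0.
    by move=> _ [d _ <-]; exists x => //; exists (c * d) => //; congr (_, _); rewrite mulgA.
  apply/seteqP; split=> x /=; last by move=> Ax; exists x => //; exists 1; rewrite ?mulg1.
  by move=> [y Ay [c _ [<- ->]]]; rewrite mulg1.
(* The first projection sends the coset of a base member at [(a, b)] onto the coset of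
   [centralizer F] at [a]: this gives both continuity and openness. *)
- split=> //.
  + move=> [a b] A /nbhs_taimanov[F finF FA].
    apply/nbhs_base; exists [set (c, c) | c in centralizer F]; first by exists F.
    by move=> _ [c Fc <-]; apply: FA; exists c.
  + move=> V oV _ [[a b] /oV[_ [F finF <-] FV] <-]; exists F => // c Fc.
    by exists ((a, b) * (c, c)) => //; apply: FV; exists c.
Qed.

End DiagonalBase.

Lemma taimanovP (G : groupType) :
  Taimanov G -> exists2 F : set G, finite_set F & centralizer F `<=` [set 1].
Proof.
move=> TG; apply/nbhs1_taimanov.
apply: open_nbhs_nbhs; split=> //.
by change (opens (taimanov_topology G) [set 1]); rewrite TG.
Qed.

Theorem theorem5p13 (G : groupType) :
  A_complete (discrete_group_topology G) <-> Taimanov G.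
Proof.
split=> [AG|/taimanovP[F finF F1] sigma _ [_]].
  by apply: AG; [|exact: semitopological_taimanov].
move=> [Gt [taut [j [ft [[injj jM] normj tauE [ftM _ ft_open] ftj]]]]].
have [V oV V1] : [set j @^-1` V | V in opens taut] [set 1] by rewrite -tauE.
have j1 : j 1 = 1 by apply: (mulgI (j 1)); rewrite -jM !mulg1.
have VE x : V (j x) -> x = 1 by rewrite -[V _]/((j @^-1` V) x) V1.
pose W := \bigcap_(g in F) [set w : topo_space taut | V [~ (w : Gt), j g]].
(* Since [F] is finite, [W] is a finite intersection of neighbourhoods of [1]. *)
have : nbhs (1 : topo_space taut) W.
  have /finite_fsetP[D DE] := finF; rewrite /W DE; apply: filter_bigI => g _.
  apply: (@continuous_commg _ taut (j g) 1 V); apply: open_nbhs_nbhs; split=> //.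
  by rewrite commgEl conj1g mulg1 invg1 -j1 -[V _]/((j @^-1` V) 1) V1.
rewrite nbhsE => -[U [oU U1] UW].
apply: open1_discrete; suff <- : ft @` U = [set 1] by exact: ft_open.
have ft1 : ft 1 = 1 by rewrite -j1 ftj.
apply/seteqP; split=> [_ [w Uw <-]|_ ->]; last by exists 1.
apply: F1 => g Fg; have := UW _ Uw g Fg => /=.
(* The commutator is a conjugate of [(j g)^-1] times [j g], so normality applies. *)
have [x _ xE] : range j [~ w, j g].
  rewrite commgEr.
  have [y _ <-] : range j ((j g)^-1 ^ w).
    apply: normj; exists g^-1 => //; apply: (mulgI (j g)).
    by rewrite -jM !mulgV.
  by exists (y * g).
rewrite -xE => /VE x1; move: xE; rewrite x1 j1 => /esym/eqP/commgP wg.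
by have := congr1 ft wg; rewrite !ftM ftj.
Qed.
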